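(* Let $k\ge 1$ be an integer. For every integer $n\ge 0$, the following identity of polynomials in $x$ holds: $$Ch_n^{(k)}(x)=\sum_{l=0}^{n}S_1(n,l)\,E_l^{(k)}(x).$$
   Context: Let $p$ be an odd prime. For a continuous function $f$ on $\mathbb{Z}_p$, the fermionic $p$-adic integral is $$\int_{\mathbb{Z}_p} f(x)\,d\mu_{-1}(x)=\lim_{N\to\infty}\sum_{x=0}^{p^N-1}f(x)(-1)^x .$$ The falling factorial is $(y)_n=y(y-1)\cdots(y-n+1)$, with $(y)_0=1$. For an integer $k\ge 1$ and $n\ge 0$, the higher-order Changhee polynomials of the first kind are defined by the iterated integral $$Ch_n^{(k)}(x)=\int_{\mathbb{Z}_p}\cdots\int_{\mathbb{Z}_p}(x_1+\cdots+x_k+x)_n\,d\mu_{-1}(x_1)\cdots d\mu_{-1}(x_k),$$ where the integrand is expanded in powers of $x$ and integrated coefficientwise, giving a polynomial in $\mathbb{Q}_p[x]$. The (signed) Stirling numbers of the first kind $S_1(n,l)$ are defined by $(x)_n=\sum_{l=0}^n S_1(n,l)x^l$. The Euler polynomials of order $k$, $E_n^{(k)}(x)\in\mathbb{Q}[x]\subset\mathbb{Q}_p[x]$, are defined by $\left(\frac{2}{e^t+1}\right)^k e^{xt}=\sum_{n=0}^\infty E_n^{(k)}(x)\frac{t^n}{n!}$. *)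

(* Defs.v *)
From HB Require Import structures.
From mathcomp Require Import all_boot all_order all_algebra.
From mathcomp Require Import generic_quotient fraction.
From mathcomp Require Import boolp classical_sets functions filter topology.

Set Implicit Arguments.
Unset Strict Implicit.
Unset Printing Implicit Defensive.

Import Order.TTheory GRing.Theory Num.Theory.

Local Open Scope classical_set_scope.
Local Open Scope ring_scope.

(* Z_p is the inverse limit of the rings Z/p^n: an element is a sequence of
   integers x_n in [0, p^n) with x_n = x_(n+1) mod p^n. The primality proof is
   a parameter of the type because the ring instances depend on it. *)
Definition coherent (p : nat) (x : nat -> int) : bool :=
  `[< forall n, x n = (x n.+1 %% (p ^ n)%N)%Z >].

Record padic_int (p : nat) (pp : prime p) := PadicInt {
  residue :> nat -> int;
  _ : coherent p residue }.

Section PadicInt.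
Variables (p : nat) (pp : prime p).

HB.instance Definition _ := [isSub for @residue p pp].
HB.instance Definition _ := [Choice of padic_int pp by <:].

Implicit Types x y z : padic_int pp.

Local Notation q n := (((p ^ n)%N : nat) : int).

Lemma residueS x n : x n = (x n.+1 %% q n)%Z.
Proof. by case: x => x /= /asboolP. Qed.

Lemma residue_mod x n : (x n %% q n)%Z = x n.
Proof. by rewrite (residueS x n) modz_mod. Qed.

Lemma eq_padic_int x y : (forall n, (x n = y n %[mod q n])%Z) -> x = y.
Proof.
move=> xy; apply/val_inj/funext => n /=.
by rewrite -(residue_mod x) xy residue_mod.
Qed.

Lemma modz_pow (a : int) n : (modz a (q n.+1) = a %[mod q n])%Z.
Proof.
apply/eqP; rewrite eqz_mod_dvd /modz addrAC subrr add0r.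
by rewrite rpredN dvdz_mull // dvdzE !absz_nat dvdn_exp2l.
Qed.

Lemma of_seq_subproof (f : nat -> int) :
  (forall n, (f n.+1 = f n %[mod q n])%Z) ->
  coherent p (fun n => (f n %% q n)%Z).
Proof. by move=> fS; apply/asboolP => n; rewrite modz_pow fS. Qed.

Definition of_seq f fS : padic_int pp := PadicInt pp (@of_seq_subproof f fS).

Lemma residueS_mod x n : (x n.+1 = x n %[mod q n])%Z.
Proof. by rewrite -residueS residue_mod. Qed.

Lemma zero_subproof n : (((fun=> 0 : int) n.+1 : int) = 0 %[mod q n])%Z.
Proof. by []. Qed.

Lemma one_subproof n : (((fun=> 1 : int) n.+1 : int) = 1 %[mod q n])%Z.
Proof. by []. Qed.

Lemma opp_subproof x n : (- x n.+1 = - x n %[mod q n])%Z.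
Proof. by rewrite -modzNm residueS_mod modzNm. Qed.

Lemma add_subproof x y n : (x n.+1 + y n.+1 = x n + y n %[mod q n])%Z.
Proof. by rewrite -modzDm !residueS_mod modzDm. Qed.

Lemma mul_subproof x y n : (x n.+1 * y n.+1 = x n * y n %[mod q n])%Z.
Proof. by rewrite -modzMm !residueS_mod modzMm. Qed.

Definition padic_zero := of_seq zero_subproof.
Definition padic_one := of_seq one_subproof.
Definition padic_opp x := of_seq (opp_subproof x).
Definition padic_add x y := of_seq (add_subproof x y).
Definition padic_mul x y := of_seq (mul_subproof x y).

Fact padic_addA : associative padic_add.
Proof.
by move=> x y z; apply: eq_padic_int => n; rewrite /= !modz_mod modzDmr modzDml addrA.
Qed.

Fact padic_addC : commutative padic_add.
Proof. by move=> x y; apply: eq_padic_int => n; rewrite /= addrC. Qed.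

Fact padic_add0 : left_id padic_zero padic_add.
Proof. by move=> x; apply: eq_padic_int => n; rewrite /= modz_mod modzDml add0r. Qed.

Fact padic_addN : left_inverse padic_zero padic_opp padic_add.
Proof. by move=> x; apply: eq_padic_int => n; rewrite /= !modz_mod modzDml addNr. Qed.

HB.instance Definition _ := GRing.isZmodule.Build (padic_int pp)
  padic_addA padic_addC padic_add0 padic_addN.

Fact padic_mulA : associative padic_mul.
Proof.
by move=> x y z; apply: eq_padic_int => n; rewrite /= !modz_mod modzMmr modzMml mulrA.
Qed.

Fact padic_mulC : commutative padic_mul.
Proof. by move=> x y; apply: eq_padic_int => n; rewrite /= mulrC. Qed.

Fact padic_mul1 : left_id padic_one padic_mul.
Proof. by move=> x; apply: eq_padic_int => n; rewrite /= modz_mod modzMml mul1r. Qed.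

Fact padic_mulDl : left_distributive padic_mul padic_add.
Proof.
move=> x y z; apply: eq_padic_int => n.
by rewrite /= !modz_mod modzMml modzDm mulrDl.
Qed.

Fact padic_one_neq0 : padic_one != 0.
Proof.
apply/eqP => /(congr1 (fun x : padic_int pp => x 1%N)) /=.
by rewrite expn1 mod0z modz_small // /= ltz_nat prime_gt1.
Qed.

HB.instance Definition _ := GRing.Zmodule_isComNzRing.Build (padic_int pp)
  padic_mulA padic_mulC padic_mul1 padic_mulDl padic_one_neq0.

Definition padic_unit : {pred padic_int pp} :=
  fun x => `[< exists y, y * x = 1 >].
Definition padic_inv x := xget x [set y | y * x = 1].

Fact padic_mulV : {in padic_unit, left_inverse 1 padic_inv *%R}.
Proof. by move=> x /asboolP xU; exact: (xgetPex x xU). Qed.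

Fact padic_unitP x y : y * x = 1 -> padic_unit x.
Proof. by move=> yx; apply/asboolP; exists y. Qed.

Fact padic_invr_out : {in [predC padic_unit], padic_inv =1 id}.
Proof.
move=> x /negP xU; rewrite /padic_inv xgetPN // => y yx.
by apply: xU; apply: padic_unitP yx.
Qed.

HB.instance Definition _ := GRing.ComNzRing_hasMulInverse.Build (padic_int pp)
  padic_mulV padic_unitP padic_invr_out.

Lemma residue_le x m n : (m <= n)%N -> (x n = x m %[mod q m])%Z.
Proof.
elim: n => [|n IHn]; first by rewrite leqn0 => /eqP->.
rewrite leq_eqVlt => /predU1P[->//|]; rewrite ltnS => mn.
rewrite -(IHn mn); apply/eqP; rewrite eqz_mod_dvd.
apply: (@dvdz_trans (q n)); first by rewrite dvdzE !absz_nat dvdn_exp2l.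
by rewrite -eqz_mod_dvd; apply/eqP; apply: residueS_mod.
Qed.

Lemma padic_neq0 x : x != 0 -> exists n, ~~ (q n %| x n)%Z.
Proof.
move=> x0; apply: contrapT => nx; case/eqP: x0; apply: eq_padic_int => n.
rewrite /= modz_mod mod0z; apply/dvdz_mod0P/contraT => xn.
by case: nx; exists n.
Qed.

Lemma ndvd_le x m n : (m <= n)%N -> ~~ (q m %| x m)%Z -> ~~ (q m %| x n)%Z.
Proof.
move=> mn; apply: contra => /dvdz_mod0P; rewrite residue_le // => xm0.
exact/dvdz_mod0P.
Qed.

Fact padic_idomain : GRing.integral_domain_axiom (padic_int pp).
Proof.
move=> x y xy0; apply/norP => -[/padic_neq0[m xm] /padic_neq0[n yn]].
pose N := (m + n)%N.
have xN : ~~ (q m %| x N)%Z by apply: ndvd_le xm; rewrite leq_addr.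
have yN : ~~ (q n %| y N)%Z by apply: ndvd_le yn; rewrite leq_addl.
have: (q N %| x N * y N)%Z.
  apply/dvdz_mod0P.
  by have /(congr1 (fun z : padic_int pp => z N)) := xy0; rewrite /= mod0z.
move: xN yN; rewrite !dvdzE abszM !absz_nat.
have [->|] := posnP `|x N|%N; first by rewrite dvdn0.
have [->|] := posnP `|y N|%N; first by rewrite dvdn0.
move=> y0 x0.
rewrite !pfactor_dvdn ?muln_gt0 ?x0 ?y0 // lognM // -!ltnNge => xm' yn'.
by rewrite leqNgt -addnS leq_add // ltnW.
Qed.

HB.instance Definition _ :=
  GRing.ComUnitRing_isIntegral.Build (padic_int pp) padic_idomain.

Definition padic : Type := {fraction padic_int pp}.

HB.instance Definition _ := GRing.Field.on padic.

Definition padic_of_int : padic_int pp -> padic := @tofrac (padic_int pp).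

HB.instance Definition _ := GRing.RMorphism.on padic_of_int.

(* The p-adic topology on Q_p: the sets a + p^m Z_p, for m in nat, form a
   neighbourhood base at a. *)
Definition padic_ball (a : padic) (m : nat) : set padic :=
  [set b | exists z : padic_int pp, b - a = p%:R ^+ m * padic_of_int z].

Definition padic_nbhs (a : padic) : set_system padic :=
  [set A | exists m, padic_ball a m `<=` A].

HB.instance Definition _ := hasNbhs.Build padic padic_nbhs.

Lemma padic_ballxx a m : padic_ball a m a.
Proof. by exists 0; rewrite subrr rmorph0 mulr0. Qed.

Lemma padic_ball_le a m n : (m <= n)%N -> padic_ball a n `<=` padic_ball a m.
Proof.
move=> mn b [z bz]; exists (p%:R ^+ (n - m) * z).
by rewrite rmorphM rmorphXn rmorph_nat mulrA -exprD subnKC.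
Qed.

Lemma padic_ball_trans a b c m :
  padic_ball a m b -> padic_ball b m c -> padic_ball a m c.
Proof.
move=> [z bz] [w cw]; exists (w + z).
by rewrite rmorphD mulrDr -bz -cw addrA subrK.
Qed.

Fact padic_nbhs_filter (a : padic) : ProperFilter (nbhs a).
Proof.
apply: Build_ProperFilter_ex.
  by move=> A [m Am]; exists a; apply: Am; apply: padic_ballxx.
split; first by exists 0%N.
  move=> A B [m Am] [n Bn]; exists (maxn m n) => b ab; split.
    by apply: Am; apply: padic_ball_le ab; apply: leq_maxl.
  by apply: Bn; apply: padic_ball_le ab; apply: leq_maxr.
by move=> A B AB [m Am]; exists m; apply: subset_trans AB.
Qed.

Fact padic_nbhs_singleton (a : padic) (A : set padic) : nbhs a A -> A a.
Proof. by move=> [m]; apply; apply: padic_ballxx. Qed.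

Fact padic_nbhs_nbhs (a : padic) (A : set padic) :
  nbhs a A -> nbhs a (nbhs^~ A).
Proof.
move=> [m Am]; exists m => b ab; exists m => c bc; apply: Am.
exact: padic_ball_trans ab bc.
Qed.

HB.instance Definition _ := Nbhs_isNbhsTopological.Build padic
  padic_nbhs_filter padic_nbhs_singleton padic_nbhs_nbhs.

HB.instance Definition _ := isPointed.Build padic 0.

Fact padic_fracP (a : padic) :
  exists2 z : padic_int pp * padic_int pp, z.2 != 0 &
    a * padic_of_int z.2 = padic_of_int z.1.
Proof.
elim/quotW: a => r; exists (\n_r, \d_r) => /=; first exact: denom_ratioP.
rewrite /padic_of_int; unlock tofrac.
rewrite -[LHS]FracField.pi_mul /FracField.mulf; apply/eqmodP.
rewrite /= FracField.equivfE !numden_Ratio ?mulr1 ?oner_eq0 ?denom_ratioP //.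
by rewrite mulrC.
Qed.

Lemma residue_nat (a n : nat) :
  (a%:R : padic_int pp) n = ((a : int) %% q n)%Z.
Proof.
elim: a => [|a IHa]; first by rewrite mulr0n /= mod0z.
by rewrite mulrSr /= IHa modzDm -addn1 PoszD.
Qed.

Fact padic_hausdorff : hausdorff_space padic.
Proof.
move=> a b ab; apply/eqP; rewrite eq_sym -subr_eq0; apply/eqP.
have abm m : padic_ball a m b.
  have [||c [[z az] [w bw]]] := ab (padic_ball a m) (padic_ball b m).
  - by exists m.
  - by exists m.
  exists (z - w); rewrite rmorphB mulrBr -az -bw.
  by rewrite opprB [RHS]addrC addrA subrK.
have [[u v] /= v0 uv] := padic_fracP (b - a).
suff u0 : u = 0.
  move/eqP: uv; rewrite u0 rmorph0 mulf_eq0 => /orP[/eqP//|].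
  by rewrite tofrac_eq0 (negPf v0).
apply: eq_padic_int => m; have [z bz] := abm m.
have /eqP : padic_of_int u = padic_of_int ((p ^ m)%:R * (z * v)).
  by rewrite -uv bz !rmorphM rmorph_nat natrX mulrA.
rewrite tofrac_eq => /eqP ->; rewrite /= residue_nat modzz mul0r.
by rewrite mod0z.
Qed.

(* The fermionic p-adic integral. [lim] is the limit in the p-adic topology,
   with the usual default value of [lim] on divergent sequences. *)
Definition fermionic_integral (f : padic_int pp -> padic) : padic :=
  lim ((fun N : nat => \sum_(0 <= x < p ^ N) f x%:R * (-1) ^+ x) @ \oo).

(* The innermost integral is over the first variable. *)
Fixpoint iterated_fermionic_integral (k : nat) :
    (k.-tuple (padic_int pp) -> padic) -> padic :=
  match k with
  | 0 => fun f => f [tuple]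
  | k'.+1 => fun f => fermionic_integral (fun y =>
      iterated_fermionic_integral (fun xs : k'.-tuple (padic_int pp) =>
        f [tuple of rcons xs y]))
  end.

End PadicInt.

Definition falling (R : comNzRingType) (y : R) (n : nat) : R :=
  \prod_(i < n) (y - i%:R).

Definition stirling1 (n l : nat) : int := (falling ('X : {poly int}) n)`_l.

Definition changhee_integrand (p : nat) (pp : prime p) (k n : nat)
    (xs : k.-tuple (padic_int pp)) : {poly padic pp} :=
  falling ((\sum_(i < k) padic_of_int (tnth xs i))%:P + 'X) n.

Lemma size_changhee_integrand (p : nat) (pp : prime p) (k n : nat)
    (xs : k.-tuple (padic_int pp)) : size (changhee_integrand n xs) = n.+1.
Proof.
rewrite /changhee_integrand /falling; set c := \sum_(i < k) _.
rewrite (eq_bigr (fun i : 'I_n => 'X - (i%:R - c)%:P)) => [|i _].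
  by rewrite size_prod_XsubC /index_enum -enumT size_enum_ord.
by rewrite polyCB polyC_natr opprB addrCA addrA.
Qed.

Definition changhee (p : nat) (pp : prime p) (k n : nat) : {poly padic pp} :=
  \poly_(j < n.+1) iterated_fermionic_integral
    (fun xs : k.-tuple (padic_int pp) => (changhee_integrand n xs)`_j).

Record fps (A : Type) := Fps { fcoef : nat -> A }.

Section FpsRing.
Variable A : comUnitRingType.

HB.instance Definition _ := [isNew for @fcoef A].
HB.instance Definition _ := [Choice of fps A by <:].

Implicit Types f g h : fps A.

Lemma eq_fps f g : fcoef f =1 fcoef g -> f = g.
Proof. by move=> fg; apply/val_inj/funext. Qed.

Definition fps_const (a : A) := Fps (fun n => if n is 0 then a else 0).
Definition fps_add f g := Fps (fun n => fcoef f n + fcoef g n).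
Definition fps_opp f := Fps (fun n => - fcoef f n).
Definition fps_mul f g :=
  Fps (fun n => \sum_(i < n.+1) fcoef f i * fcoef g (n - i)).

Fact fps_addA : associative fps_add.
Proof. by move=> f g h; apply: eq_fps => n /=; rewrite addrA. Qed.

Fact fps_addC : commutative fps_add.
Proof. by move=> f g; apply: eq_fps => n /=; rewrite addrC. Qed.

Fact fps_add0 : left_id (fps_const 0) fps_add.
Proof. by move=> f; apply: eq_fps => -[|n] /=; rewrite add0r. Qed.

Fact fps_addN : left_inverse (fps_const 0) fps_opp fps_add.
Proof. by move=> f; apply: eq_fps => -[|n] /=; rewrite addNr. Qed.

HB.instance Definition _ := GRing.isZmodule.Build (fps A)
  fps_addA fps_addC fps_add0 fps_addN.

Lemma fps_mul_poly (p q : {poly A}) f g n :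
  (forall i, (i <= n)%N -> p`_i = fcoef f i) ->
  (forall i, (i <= n)%N -> q`_i = fcoef g i) ->
  (p * q)`_n = fcoef (fps_mul f g) n.
Proof.
move=> pf qg; rewrite coefM /=; apply: eq_bigr => i _.
by rewrite pf ?qg ?leq_subr // -ltnS.
Qed.

Definition trunc n f : {poly A} := \poly_(i < n.+1) fcoef f i.

Lemma coef_trunc n f i : (i <= n)%N -> (trunc n f)`_i = fcoef f i.
Proof. by move=> i_n; rewrite coef_poly ltnS i_n. Qed.

Fact fps_mulA : associative fps_mul.
Proof.
move=> f g h; apply: eq_fps => n.
have H (u v : fps A) i : (i <= n)%N ->
    (trunc n u * trunc n v)`_i = fcoef (fps_mul u v) i.
  move=> i_n; apply: fps_mul_poly => j ji; apply: coef_trunc;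
  exact: leq_trans ji i_n.
have T := @coef_trunc n.
rewrite -(fps_mul_poly (p := trunc n f) (q := trunc n g * trunc n h)) //;
  [|exact: T|exact: H].
by rewrite mulrA; apply: fps_mul_poly; [exact: H|exact: T].
Qed.

Fact fps_mulC : commutative fps_mul.
Proof.
move=> f g; apply: eq_fps => n.
have T := @coef_trunc n.
rewrite -(fps_mul_poly (T f) (T g)) mulrC.
by apply: fps_mul_poly; apply: T.
Qed.

Fact fps_mul1 : left_id (fps_const 1) fps_mul.
Proof.
move=> f; apply: eq_fps => n /=.
by rewrite big_ord_recl /= mul1r subn0 big1 ?addr0 // => i _; rewrite mul0r.
Qed.

Fact fps_mulDl : left_distributive fps_mul fps_add.
Proof.
move=> f g h; apply: eq_fps => n /=.
by rewrite -big_split /=; apply: eq_bigr => i _; rewrite mulrDl.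
Qed.

Fact fps_one_neq0 : fps_const 1 != 0.
Proof.
apply/eqP => /(congr1 (fun f : fps A => fcoef f 0)) /= /eqP.
by rewrite (negPf (oner_neq0 _)).
Qed.

HB.instance Definition _ := GRing.Zmodule_isComNzRing.Build (fps A)
  fps_mulA fps_mulC fps_mul1 fps_mulDl fps_one_neq0.

(* The coefficients b_0, ..., b_n of 1 / f, from f_0 b_0 = 1 and
   f_0 b_n = - (f_1 b_(n-1) + ... + f_n b_0). *)
Fixpoint inv_coefs f (n : nat) : seq A :=
  if n is m.+1 then
    let b := inv_coefs f m in
    rcons b (- (fcoef f 0)^-1 * \sum_(i < n) fcoef f i.+1 * b`_(m - i))
  else [:: (fcoef f 0)^-1].

Definition fps_unit : {pred fps A} := fun f => fcoef f 0 \is a GRing.unit.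
Definition fps_inv f :=
  if fps_unit f then Fps (fun n => (inv_coefs f n)`_n) else f.

Lemma size_inv_coefs f n : size (inv_coefs f n) = n.+1.
Proof. by elim: n => //= n IHn; rewrite size_rcons IHn. Qed.

Lemma nth_inv_coefs f n i : (i <= n)%N ->
  (inv_coefs f n)`_i = (inv_coefs f i)`_i.
Proof.
elim: n => [|n IHn]; first by rewrite leqn0 => /eqP->.
rewrite leq_eqVlt => /predU1P[->//|]; rewrite ltnS => i_n.
by rewrite /= nth_rcons size_inv_coefs ltnS i_n IHn.
Qed.

Fact fps_mulV : {in fps_unit, left_inverse 1 fps_inv *%R}.
Proof.
move=> f fU; rewrite /fps_inv ifT //.
transitivity (fps_mul f (Fps (fun n => (inv_coefs f n)`_n))).
  exact: fps_mulC.
apply: eq_fps => -[|n].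
  by rewrite /= big_ord1 /= divrr.
rewrite /= big_ord_recl subn0 /= nth_rcons size_inv_coefs.
rewrite ltnn eqxx !mulNr mulrN mulrA divrr // mul1r.
apply/eqP; rewrite addrC subr_eq0; apply/eqP; apply: eq_bigr => i _.
by rewrite /bump /= add1n subSS [in RHS]nth_inv_coefs ?leq_subr.
Qed.

Fact fps_unitP f g : g * f = 1 -> fps_unit f.
Proof.
move/(congr1 (fun h : fps A => fcoef h 0)).
rewrite /= big_ord1 /= subnn => gf.
by apply/unitrPr; exists (fcoef g 0); rewrite mulrC.
Qed.

Fact fps_inv_out : {in [predC fps_unit], fps_inv =1 id}.
Proof. by move=> f /negPf fU; rewrite /fps_inv ifN // [fps_unit f]fU. Qed.

HB.instance Definition _ := GRing.ComNzRing_hasMulInverse.Build (fps A)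
  fps_mulV fps_unitP fps_inv_out.

End FpsRing.

(* The power series e^(a t) in t, over Q[x]. *)
Definition fps_exp (a : {poly rat}) : fps {poly rat} :=
  Fps (fun n => (n`!%:R)^-1 *: a ^+ n).

Definition euler_gf (k : nat) : fps {poly rat} :=
  (2 / (fps_exp 1 + 1)) ^+ k * fps_exp 'X.

(* The Euler polynomial of order k, n! times the coefficient of t^n. *)
Definition euler (k n : nat) : {poly rat} :=
  n`!%:R *: fcoef (euler_gf k) n.

(* Main.v *)
(* Write S for the shift x -> x + 1. The factor 2 / (e^t + 1) of the generating
   function gives (S + 1) E_l^(k+1) = 2 E_l^(k), with E_l^(0) = x^l. If
   (S + 1) G = 2 F for polynomials F and G, then the alternating sum of F(x + c)
   over 0 <= x < p^N telescopes to (G(c) + G(c + p^N)) / 2, which tends p-adically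
   to G(c) as N grows. So each fermionic integration raises the order of the Euler
   polynomials by one, and k of them turn the expansion of (x)_n in powers of x
   into the sum of the S_1(n, l) E_l^(k). *)
Require Import Defs.
From HB Require Import structures.
From mathcomp Require Import all_boot all_order all_algebra.
From mathcomp Require Import ring.
From mathcomp Require Import boolp classical_sets topology.

Set Implicit Arguments.
Unset Strict Implicit.
Unset Printing Implicit Defensive.

Import Order.TTheory GRing.Theory Num.Theory.
Local Open Scope ring_scope.

(** * Power series and the shift recursion of the Euler polynomials *)

Section FpsMap.
Variables (A B : comUnitRingType) (phi : {rmorphism A -> B}).

Definition fps_map (f : fps A) : fps B := Fps (fun n => phi (fcoef f n)).

Fact fps_map_is_zmod_morphism : zmod_morphism fps_map.
Proof. by move=> f g; apply: eq_fps => n; rewrite /= rmorphB. Qed.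

Fact fps_map_is_monoid_morphism : monoid_morphism fps_map.
Proof.
split=> [|f g]; apply: eq_fps => n /=.
  by case: n => [|n]; rewrite ?rmorph1 ?rmorph0.
by rewrite rmorph_sum; apply: eq_bigr => i _; rewrite rmorphM.
Qed.

HB.instance Definition _ := GRing.isZmodMorphism.Build (fps A) (fps B) fps_map
  fps_map_is_zmod_morphism.
HB.instance Definition _ := GRing.isMonoidMorphism.Build (fps A) (fps B) fps_map
  fps_map_is_monoid_morphism.

End FpsMap.

Lemma fact_rat_neq0 n : n`!%:R != 0 :> rat.
Proof. by rewrite pnatr_eq0 -lt0n fact_gt0. Qed.

Lemma fps_expD (a b : {poly rat}) : fps_exp (a + b) = fps_exp a * fps_exp b.
Proof.
apply: eq_fps => n /=; rewrite addrC exprDn scaler_sumr; apply: eq_bigr => i _.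
rewrite -scalerAl -scalerAr scalerA [a ^+ i * _]mulrC -scaler_nat scalerA.
congr (_ *: _); have in_ : (i <= n)%N by rewrite -ltnS.
rewrite -(bin_fact in_) !natrM !invfM mulrAC mulVf ?mul1r //.
by rewrite pnatr_eq0 -lt0n bin_gt0.
Qed.

Lemma fps_exp_unit a : fps_exp a + 1 \is a GRing.unit.
Proof.
rewrite unfold_in /= /fps_unit /= fact0 invr1 scale1r expr0.
by rewrite (_ : 1 + 1 = 2%:R) // -(rmorph_nat (@polyC rat)) rmorph_unit.
Qed.

Definition shift_poly : {poly rat} -> {poly rat} := comp_poly ('X + 1).
HB.instance Definition _ := GRing.LRMorphism.on shift_poly.

Lemma fps_map_exp a : fps_map shift_poly (fps_exp a) = fps_exp (shift_poly a).
Proof. by apply: eq_fps => n; rewrite /= linearZ rmorphXn. Qed.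

(** The shift fixes 2 / (e^t + 1) and multiplies e^(xt) by e^t. Adding the unshifted series gives a
    factor e^t + 1, which cancels one denominator. *)
Lemma euler_gf_rec k :
  fps_map shift_poly (euler_gf k.+1) + euler_gf k.+1 = 2 * euler_gf k.
Proof.
rewrite /euler_gf rmorphM rmorphXn rmorph_div ?fps_exp_unit //= rmorph_nat.
rewrite rmorphD rmorph1 /= !fps_map_exp rmorph1 /shift_poly /= comp_polyX.
(* The 2 on the right becomes (2 / (e^t + 1)) (e^t + 1), so that [ring] has nothing to cancel. *)
rewrite fps_expD -{3}(mulrVK (fps_exp_unit 1) 2) exprS; ring.
Qed.

Lemma euler_rec k n :
  euler k.+1 n \Po ('X + 1) + euler k.+1 n = 2 *: euler k n.
Proof.
have /(congr1 (fun f => fcoef f n)) := euler_gf_rec k.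
rewrite mulr_natl mulr2n /= => E.
rewrite /euler linearZ /= -scalerDr [_ + _]E -mulr2n -scaler_nat.
by rewrite !scalerA mulrC.
Qed.

Lemma euler0 n : euler 0 n = 'X^n.
Proof.
by rewrite /euler /euler_gf expr0 mul1r /= scalerA mulfV ?scale1r ?fact_rat_neq0.
Qed.

(** * Taylor coefficients, falling factorials and Stirling numbers *)

Lemma taylor_coef (R : comNzRingType) (q : {poly R}) (c : R) j :
  (q \Po (c%:P + 'X))`_j = q^`N(j).[c].
Proof.
rewrite /comp_poly nderiv_taylor; last exact: mulrC.
rewrite size_map_polyC coef_sum.
rewrite (eq_bigr (fun i : 'I_(size q) => q^`N(i).[c] * (j == i)%:R)).
  have [jq|qj] := ltnP j (size q).
    rewrite (bigD1 (Ordinal jq)) //= eqxx mulr1 big1 ?addr0 // => i ij.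
    by rewrite (_ : (j == i) = false) ?mulr0 //; apply/negbTE; rewrite eq_sym.
  rewrite big1 => [|i _]; first by rewrite nderivn_poly0 ?horner0.
  by rewrite (gtn_eqF (leq_trans (ltn_ord i) qj)) mulr0.
by move=> i _; rewrite nderivn_map horner_map /= coefCM coefXn.
Qed.


(** Divided derivatives are Taylor coefficients: substitute x + ['X] into the hypothesis and compare
    coefficients of degree j. *)
Lemma nderivn_shift (R : comNzRingType) (G H : {poly R}) (a : R) j x :
  G \Po ('X + 1) + G = a *: H ->
  G^`N(j).[x + 1] + G^`N(j).[x] = a * H^`N(j).[x].
Proof.
move=> GH; rewrite -!taylor_coef -coefZ -linearZ /= -GH linearD coefD /=.
congr (_`_j + _); rewrite -comp_polyA; congr comp_poly.
by rewrite linearD /= rmorph1 comp_polyX polyCD polyC1 addrAC.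
Qed.

Lemma map_falling (R S : comNzRingType) (f : {rmorphism R -> S}) y n :
  f (falling y n) = falling (f y) n.
Proof.
by rewrite rmorph_prod; apply: eq_bigr => i _; rewrite rmorphB rmorph_nat.
Qed.

Lemma falling_stirling1 (R : comNzRingType) n :
  \sum_(0 <= l < n.+1) (stirling1 n l)%:~R *: 'X^l = falling ('X : {poly R}) n.
Proof.
have size_f : size (falling ('X : {poly int}) n) = n.+1.
  rewrite /falling (eq_bigr (fun i : 'I_n => 'X - (i%:R)%:P)) => [|i _].
    by rewrite size_prod_XsubC /index_enum -enumT size_enum_ord.
  by rewrite polyC_natr.
transitivity (map_poly (intr : int -> R) (falling 'X n)); last first.
  by rewrite map_falling /= map_polyX.
rewrite -[X in map_poly _ X]coefK poly_def.
rewrite size_f big_mkord rmorph_sum; apply: eq_bigr => l _.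
by rewrite /= map_polyZ /= map_polyXn.
Qed.

(** * The embedding of the rationals into a field of characteristic zero *)

Section RatrCharZero.
Variables (F : fieldType) (intF_eq0 : forall m : int, (m%:~R == 0 :> F) = (m == 0)).

(** [ratr] is defined by the reduced fraction; allowing any fraction lets sums and products use the
    product of the denominators. *)
Lemma ratr_frac (a : rat) (m d : int) : d != 0 -> a * d%:~R = m%:~R ->
  ratr a = m%:~R / d%:~R :> F.
Proof.
move=> d0 ad; have dF : d%:~R != 0 :> F by rewrite intF_eq0.
have aF : (denq a)%:~R != 0 :> F by rewrite intF_eq0 denq_eq0.
have /intr_inj E : (numq a * d)%:~R = (m * denq a)%:~R :> rat.
  by rewrite !intrM numqE mulrAC ad.
by apply/eqP; rewrite /ratr eqr_div // -!intrM E.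
Qed.

Lemma ratr_zmod_morphism : zmod_morphism (@ratr F).
Proof.
move=> a b; have Da := denq_neq0 a; have Db := denq_neq0 b.
rewrite (@ratr_frac _ (numq a * denq b - numq b * denq a) (denq a * denq b)).
- rewrite /ratr !(intrD, intrM, mulrNz).
  by field; rewrite !intF_eq0 Da Db.
- by rewrite mulf_neq0.
- rewrite !(intrD, intrM, mulrNz) !numqE; ring.
Qed.

Lemma ratr_monoid_morphism : monoid_morphism (@ratr F).
Proof.
split=> [|a b]; first by rewrite /ratr divr1.
have Da := denq_neq0 a; have Db := denq_neq0 b.
rewrite (@ratr_frac _ (numq a * numq b) (denq a * denq b)).
- rewrite /ratr !intrM.
  by field; rewrite !intF_eq0 Da Db.
- by rewrite mulf_neq0.
- rewrite !intrM !numqE; ring.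
Qed.

End RatrCharZero.

(** * Telescoping alternating sums *)

Lemma alternating_sum (R : comNzRingType) (F G : R -> R) (c : R) (M : nat) :
  (forall x, G (x + 1) + G x = F x) ->
  \sum_(0 <= x < M) F (x%:R + c) * (-1) ^+ x = G c - (-1) ^+ M * G (c + M%:R).
Proof.
move=> GF; elim: M => [|M IH]; first by rewrite big_geq // addr0 mul1r subrr.
rewrite big_nat_recr //= {}IH -GF -natr1 exprS [M%:R + c]addrC addrA; ring.
Qed.

(** For odd M the two end terms add up. Their half-sum is the value at c + M of a polynomial
    independent of M, so for M = p^N the limit only needs continuity of polynomials. *)
Lemma alternating_sum_poly (K : fieldType) (F G : {poly K}) (c : K) (M : nat) :
    2 != 0 :> K -> odd M -> (forall x, G.[x + 1] + G.[x] = 2 * F.[x]) ->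
  \sum_(0 <= x < M) F.[x%:R + c] * (-1) ^+ x =
    (2^-1 *: (G.[c]%:P + G)).[c + M%:R].
Proof.
move=> two0 M_odd GF.
rewrite (alternating_sum (F := horner F) (G := horner (2^-1 *: G))) => [|x].
  by rewrite -signr_odd M_odd expr1 !(hornerZ, hornerD, hornerC); ring.
by rewrite !hornerZ -mulrDr GF mulKf.
Qed.

Lemma half_sum_poly (K : fieldType) (G : {poly K}) (c : K) :
  2 != 0 :> K -> (2^-1 *: (G.[c]%:P + G)).[c] = G.[c].
Proof. by move=> two0; rewrite !(hornerZ, hornerD, hornerC); field. Qed.

(** * Denominators in Q_p and p-adic continuity of polynomials *)

Section Padic.
Variables (p : nat) (pp : prime p).
Local Notation Zp := (padic_int pp).
Local Notation Qp := (padic pp).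
Local Notation q n := (((p ^ n)%N : nat) : int).

Lemma padic_of_int_eq0 (z : Zp) : (padic_of_int z == 0) = (z == 0).
Proof. exact: tofrac_eq0. Qed.

Lemma padic_int_nat_eq0 n : (n%:R == 0 :> Zp) = (n == 0)%N.
Proof.
apply/eqP/eqP => [n0|->//]; apply/eqP/contraT; rewrite -lt0n => n_gt0.
have /(congr1 (fun x : Zp => x n)) := n0; rewrite residue_nat.
rewrite modz_small; last by rewrite ltz_nat ltn_expl ?prime_gt1.
by rewrite /= mod0z => -[E]; rewrite E in n_gt0.
Qed.

Lemma padic_nat_eq0 n : (n%:R == 0 :> Qp) = (n == 0)%N.
Proof.
by rewrite -(rmorph_nat (@padic_of_int p pp)) padic_of_int_eq0 padic_int_nat_eq0.
Qed.

Lemma padic_int_eq0 (m : int) : (m%:~R == 0 :> Qp) = (m == 0).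
Proof.
by case: m => n; rewrite ?NegzE ?mulrNz ?oppr_eq0 -pmulrn padic_nat_eq0.
Qed.

(* A name for [ratr] at Q_p to carry a ring morphism instance: the library
   provides it for ratr only over a numFieldType. *)
Definition padic_of_rat : rat -> Qp := ratr.

HB.instance Definition _ := GRing.isZmodMorphism.Build rat Qp padic_of_rat
  (ratr_zmod_morphism padic_int_eq0).
HB.instance Definition _ := GRing.isMonoidMorphism.Build rat Qp padic_of_rat
  (ratr_monoid_morphism padic_int_eq0).

(** Valuations add, and b accounts for fewer than m of the n + m factors p. *)
Lemma dvd_ppow_mul m n (a b : int) :
  ~~ (q m %| b)%Z -> (q (n + m) %| a * b)%Z -> (q n %| a)%Z.
Proof.
rewrite !dvdzE abszM !absz_nat => bm.
have [->|a_gt0] := posnP `|a|%N; first by rewrite dvdn0.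
have [b0|b_gt0] := posnP `|b|%N; first by rewrite b0 dvdn0 in bm.
move: bm; rewrite !pfactor_dvdn ?muln_gt0 ?a_gt0 // lognM // -ltnNge => bm ab.
by rewrite leqNgt; apply/negP => an; move: ab; rewrite leqNgt -addSn leq_add // ltnW.
Qed.

(** The gcd of b and p^n is some p^j, with j <= m because p^m does not divide b; its Bezout relation
    is multiplied by p^(m - j). *)
Lemma ppow_bezout m n (b : int) :
  ~~ (q m %| b)%Z -> exists w, (w * b = q m %[mod q n])%Z.
Proof.
move=> bm; have [u [v uv]] := Bezoutz b (q n).
have /(dvdn_pfactor _ _ pp)[j _ gE] : (gcdn `|b| (p ^ n) %| p ^ n)%N.
  exact: dvdn_gcdr.
have jm : (j <= m)%N.
  apply: contraR bm; rewrite -ltnNge => mj; rewrite dvdzE absz_nat.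
  by apply: dvdn_trans (dvdn_gcdl _ (p ^ n)); rewrite gE dvdn_exp2l // ltnW.
exists (q (m - j) * u); apply/eqP; rewrite eqz_mod_dvd.
have -> : q m = q (m - j) * q j by rewrite -PoszM -expnD subnK.
have -> : q j = u * b + v * q n by rewrite uv /gcdz absz_nat gE.
rewrite -mulrA -mulrBr opprD addrA subrr add0r.
by rewrite dvdz_mull // rpredN dvdz_mull.
Qed.

(** Q_p is built as a fraction field, but its topology is given by powers of p; this reduces every
    denominator to such a power. *)
Lemma padic_int_dvd_ppow (v : Zp) : v != 0 -> exists e w, w * v = p%:R ^+ e.
Proof.
move=> /padic_neq0[e ve].
have ven n : ~~ (q e %| v (n + e)%N)%Z by apply: ndvd_le ve; apply: leq_addl.
(* By Bezout, w n * v = p^e modulo p^(n + e), which determines w n modulo p^n. *)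
have [w wv] := choice (fun n => ppow_bezout (n + e) (ven n)).
(* The relations for n + 1 and n agree modulo p^(n + e), and cancelling [v (n + e)] costs at most e
   factors p. *)
have wS n : (w n.+1 = w n %[mod q n])%Z.
  apply/eqP; rewrite eqz_mod_dvd; apply: dvd_ppow_mul (ven n) _.
  rewrite mulrBl -eqz_mod_dvd wv; apply/eqP.
  have <- : (w n.+1 * v (n.+1 + e)%N = q e %[mod q (n + e)])%Z.
    apply/eqP; rewrite eqz_mod_dvd.
    apply: (@dvdz_trans (q (n.+1 + e))); last by rewrite -eqz_mod_dvd wv.
    by rewrite dvdzE !absz_nat dvdn_exp2l // addSn.
  by rewrite -[RHS]modzMmr (residue_le v (leqnSn (n + e))) modzMmr.
exists e, (of_seq pp wS); apply: eq_padic_int => n; rewrite -natrX residue_nat.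
rewrite /= !modz_mod modzMml -modzMmr -(residue_le v (leq_addr e n)) modzMmr.
apply/eqP; rewrite eqz_mod_dvd; apply: (@dvdz_trans (q (n + e))).
  by rewrite dvdzE !absz_nat dvdn_exp2l // leq_addr.
by rewrite -eqz_mod_dvd wv.
Qed.

Lemma padic_ppow_mul_int (a : Qp) :
  exists e z, p%:R ^+ e * a = padic_of_int z.
Proof.
have [[u v] /= v0 av] := padic_fracP a; have [e [w wv]] := padic_int_dvd_ppow v0.
exists e, (w * u); rewrite rmorphM /= -av mulrCA -rmorphM wv rmorphXn rmorph_nat.
exact: mulrC.
Qed.

(** Induction step of the Lipschitz bound, passing from G to G X + a: g and g' are the values of G
    at c and c + h, and r, s, t clear the denominators of the increment of G, of c and of g. *)
Lemma product_increment (R : comNzRingType) (a c g g' h r s t z : R) :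
  r * (g' - g) = h * z ->
  r * s * t * (g' * (c + h) + a - (g * c + a)) =
    h * (z * (s * c + s * h) * t + r * s * (t * g)).
Proof.
move=> E; transitivity (h * z * ((s * c + s * h) * t) + h * (r * s * (t * g))).
  by rewrite -E; ring.
by ring.
Qed.

(** Induction along Horner's scheme. The exponent e absorbs the denominators of G and c and must not
    depend on N. *)
Lemma padic_poly_lipschitz (G : {poly Qp}) (c : Qp) : exists e, forall N,
  exists z, p%:R ^+ e * (G.[c + p%:R ^+ N] - G.[c]) = p%:R ^+ N * padic_of_int z.
Proof.
elim/poly_ind: G => [|G a [e1 IH]].
  by exists 0%N => N; exists 0; rewrite !horner0 subrr rmorph0 !mulr0.
have [e2 [zc zcE]] := padic_ppow_mul_int c.
have [e3 [zg zgE]] := padic_ppow_mul_int G.[c].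
exists (e1 + e2 + e3)%N => N; have [z zE] := IH N.
exists (z * (zc + p%:R ^+ e2 * p%:R ^+ N) * p%:R ^+ e3 + p%:R ^+ (e1 + e2) * zg).
rewrite !(rmorphD, rmorphM, rmorphXn, rmorph_nat) /= -zcE -zgE !hornerMXaddC.
rewrite !exprD; exact: product_increment zE.
Qed.

Lemma padic_poly_cvg (G : {poly Qp}) (c : Qp) :
  ((G.[c + p%:R ^+ N] @[N --> \oo]) --> G.[c])%classic.
Proof.
move=> A [m Am]; have [e He] := padic_poly_lipschitz G c.
(* Dividing p^N by the p^e of the Lipschitz bound still leaves a factor p^m. *)
exists (e + m)%N => // N /= leN; apply: Am; have [z zE] := He N.
exists (p%:R ^+ (N - (e + m)) * z); rewrite rmorphM rmorphXn rmorph_nat.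
have pe : p%:R ^+ e != 0 :> Qp.
  by rewrite expf_neq0 // padic_nat_eq0 -lt0n prime_gt0.
by apply: (mulfI pe); rewrite zE !mulrA -!exprD subnKC.
Qed.

(** * Fermionic integrals of polynomials *)

Hypothesis p_odd : odd p.

Lemma fermionic_integral_poly (F G : {poly Qp}) (c : Qp) :
  (forall x, G.[x + 1] + G.[x] = 2 * F.[x]) ->
  fermionic_integral (fun y : Zp => F.[padic_of_int y + c]) = G.[c].
Proof.
move=> GF; apply: cvg_lim; first exact: padic_hausdorff.
have two0 : 2 != 0 :> Qp by rewrite padic_nat_eq0.
(* G(c) becomes the value at c of the polynomial H whose values at c + p^N are the partial sums. *)
rewrite -(half_sum_poly G c two0); set H := 2^-1 *: _.
rewrite [X in (X @ _)%classic](_ : _ = fun N => H.[c + p%:R ^+ N]).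
  exact: padic_poly_cvg.
apply/funext => N; under eq_bigr do rewrite rmorph_nat.
by rewrite (alternating_sum_poly _ two0 _ GF) ?oddX ?p_odd ?orbT // natrX.
Qed.

Lemma iterated_fermionic_integral_poly (F : nat -> {poly Qp}) k (c : Qp) :
  (forall i x, (F i.+1).[x + 1] + (F i.+1).[x] = 2 * (F i).[x]) ->
  iterated_fermionic_integral (fun xs : k.-tuple Zp =>
    (F 0%N).[\sum_(i < k) padic_of_int (tnth xs i) + c]) = (F k).[c].
Proof.
move=> FS; elim: k c => [|k IH] c /=; first by rewrite big_ord0 add0r.
rewrite -(fermionic_integral_poly c (FS k)); congr fermionic_integral.
(* The outer variable y joins the constant: the induction hypothesis is used at
   [padic_of_int y + c]. *)
apply/funext => y; rewrite -IH; congr iterated_fermionic_integral.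
apply/funext => xs; congr horner; rewrite addrA; congr (_ + c).
rewrite -(big_tuple _ _ [tuple of rcons xs y] xpredT (@padic_of_int p pp)) /=.
by rewrite big_rcons /= big_tuple.
Qed.

End Padic.

Theorem corollary2p4 (p : nat) (pp : prime p) (p_odd : odd p)
    (k : nat) (hk : (1 <= k)%N) (n : nat) :
  changhee pp k n =
    \sum_(0 <= l < n.+1)
      (stirling1 n l)%:~R *: map_poly (ratr : rat -> padic pp) (euler k l).
Proof.
(* This family leads from (x)_n at i = 0 to the claimed right-hand side at i = k. *)
pose G i : {poly padic pp} := \sum_(0 <= l < n.+1)
  (stirling1 n l)%:~R *: map_poly (padic_of_rat pp) (euler i l).
change (changhee pp k n = G k).
have GS i : G i.+1 \Po ('X + 1) + G i.+1 = 2 *: G i.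
  rewrite /G linear_sum -big_split scaler_sumr /=; apply: eq_bigr => l _.
  rewrite linearZ /= -scalerDr scalerA mulrC -scalerA; congr (_ *: _).
  have := congr1 (map_poly (padic_of_rat pp)) (euler_rec i l).
  rewrite rmorphD /= map_comp_poly rmorphD rmorph1 /= map_polyX => ->.
  by rewrite map_polyZ /= rmorph_nat.
have G0 : G 0%N = falling 'X n.
  rewrite -falling_stirling1; apply: eq_bigr => l _.
  by rewrite euler0 map_polyXn.
(* Integration is coefficientwise, and the coefficient of degree j in the integrand is the j-th
   divided derivative of (x)_n at the sum of the variables. *)
apply/polyP => j; pose F i := (G i)^`N(j).
have FS i x : (F i.+1).[x + 1] + (F i.+1).[x] = 2 * (F i).[x].
  exact: nderivn_shift.
have Gj : (G k)`_j = iterated_fermionic_integral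
    (fun xs : k.-tuple (padic_int pp) => (changhee_integrand n xs)`_j).
  rewrite -[G k]comp_polyXr -['X]add0r -polyC0 taylor_coef.
  rewrite -(iterated_fermionic_integral_poly p_odd k 0 FS).
  congr iterated_fermionic_integral; apply/funext => xs.
  by rewrite addr0 /F G0 -taylor_coef map_falling /= comp_polyX.
(* For j > n the integrand vanishes, hence so does the integral. *)
rewrite coef_poly Gj; case: ltnP => // nj.
(* The zero family satisfies the recursion too, so the same formula evaluates the integral of 0. *)
have F0S (i : nat) (x : padic pp) : 0.[x + 1] + 0.[x] = 2 * 0.[x] :> padic pp.
  by rewrite !horner0 mulr0 addr0.
rewrite -[LHS](horner0 0) -(iterated_fermionic_integral_poly p_odd k 0 F0S).
congr iterated_fermionic_integral; apply/funext => xs.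
by rewrite horner0 nth_default // size_changhee_integrand.
Qed.
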